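(* Let $X$ be a semilattice, $G$ an Abelian group, and let $\Xi$ be the lattice of equivalence classes of finite sequences from $X$. Then $X$ embeds (as a semilattice) into $\Xi$ via $x\mapsto[x]$. The group $\mathfrak F(X,G)$ is group isomorphic to $\{T\in\mathfrak F_m(\Xi,G):T(\emptyset)=0\}$ via the identity $$T(\xi)=\sum_{\emptyset\ne b\subseteq[N]}\nu(b)\,f\Big(\bigwedge_{n\in b}x_n\Big),\qquad \xi=[x_1,\ldots,x_N]\in\Xi .$$ Moreover, for $f\in\mathfrak F(X,G)$ and $T$ corresponding to each other under this identity: (i) $f$ is modular if and only if $T([x_1,\ldots,x_N])=T\big(\big[\bigvee_{1\le n\le N}x_n\big]\big)$ for all $x_1,\ldots,x_N\in X$ such that $\bigvee_{1\le n\le N}x_n$ exists in $X$; (ii) if $G$ is partially ordered, then $T$ is monotonic if and only if $T(\xi)\le f(x)$ for all $\xi\in\Xi$ and $x\in X$ with $\xi\le[x]$.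
   Context: A semilattice is a commutative idempotent semigroup $(X,\wedge)$, ordered by $x\le y$ iff $x=x\wedge y$; then $x\wedge y$ is the greatest lower bound of $\{x,y\}$. A semilattice embedding is an injective map preserving $\wedge$. For $x_1,\ldots,x_N\in X$, $\bigvee_{n}x_n$ denotes the least upper bound in $X$, when it exists. $[N]=\{1,\ldots,N\}$ and $\nu(b)=(-1)^{1+|b|}$ for a finite set $b$. $\mathfrak F(X,G)$ is the group (pointwise addition) of all functions $X\to G$. For a semilattice $Y$ (in particular for $Y=X$ or $Y=\Xi$), $f\in\mathfrak F(Y,G)$ is modular, $f\in\mathfrak F_m(Y,G)$, if $f\big(\bigvee_{1\le n\le N}y_n\big)=\sum_{\emptyset\ne b\subseteq[N]}\nu(b)f\big(\bigwedge_{n\in b}y_n\big)$ for all $N\ge1$ and $y_1,\ldots,y_N\in Y$ whose least upper bound exists in $Y$. On finite sequences (including the empty one) of elements of $X$ put $\langle x_1,\ldots,x_N\rangle\le\langle z_1,\ldots,z_M\rangle$ if for every $n\in[N]$ there is $m\in[M]$ with $x_n\le z_m$ (so the empty sequence $\emptyset$ is below every sequence). $\Xi$ is the quotient of the set of finite sequences by the equivalence relation ($\le$ and $\ge$) induced by this preorder, with the induced partial order; $[x_1,\ldots,x_N]$ is the class of $\langle x_1,\ldots,x_N\rangle$, and $\emptyset$ also denotes the class of the empty sequence. $\Xi$ is a lattice with $[x_1,\ldots,x_N]\wedge[z_1,\ldots,z_M]=[x_n\wedge z_m: n\in[N],m\in[M]]$ and $[x_1,\ldots,x_N]\vee[z_1,\ldots,z_M]=[x_1,\ldots,x_N,z_1,\ldots,z_M]$.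 ''$G$ partially ordered'' means that $G$ is a partially ordered Abelian group; $T$ is monotonic if $\xi\le\zeta$ implies $T(\xi)\le T(\zeta)$. *)

(* Defs.v *)
From HB Require Import structures.
From mathcomp Require Import all_boot all_order all_algebra.
From mathcomp Require Import boolp classical_sets functions.

Set Implicit Arguments.
Unset Strict Implicit.
Unset Printing Implicit Defensive.

Import Order.TTheory GRing.Theory.
Local Open Scope quotient_scope.
Local Open Scope order_scope.

Section Xi.
Context {d : Order.disp_t} {X : meetSemilatticeType d}.
Implicit Types s t u : seq X.

Definition seq_le : rel (seq X) :=
  fun s t => all (fun x => has (fun z => x <= z) t) s.

Lemma seq_leP s t :
  reflect (forall x, x \in s -> exists2 z, z \in t & x <= z) (seq_le s t).
Proof.
apply: (iffP allP) => st x xs; first by have /hasP[z zt xz] := st x xs; exists z.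
by have [z zt xz] := st x xs; apply/hasP; exists z.
Qed.

Lemma seq_le_refl : reflexive seq_le.
Proof. by move=> s; apply/seq_leP => x xs; exists x. Qed.

Lemma seq_le_trans : transitive seq_le.
Proof.
move=> t s u /seq_leP st /seq_leP tu; apply/seq_leP => x /st[y /tu[z zu yz] xy].
by exists z => //; apply: le_trans yz.
Qed.

Definition seq_equiv : rel (seq X) := fun s t => seq_le s t && seq_le t s.

Lemma seq_equiv_refl : reflexive seq_equiv.
Proof. by move=> s; rewrite /seq_equiv seq_le_refl. Qed.

Lemma seq_equiv_sym : symmetric seq_equiv.
Proof. by move=> s t; rewrite /seq_equiv andbC. Qed.

Lemma seq_equiv_trans : transitive seq_equiv.
Proof.
move=> t s u /andP[st ts] /andP[tu ut].
by rewrite /seq_equiv (seq_le_trans st tu) (seq_le_trans ut ts).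
Qed.

Canonical seq_equiv_rel :=
  EquivRel seq_equiv seq_equiv_refl seq_equiv_sym seq_equiv_trans.

Definition seq_meet s t : seq X := [seq x `&` z | x <- s, z <- t].

Lemma seq_lexI u s t : seq_le u (seq_meet s t) = seq_le u s && seq_le u t.
Proof.
apply/idP/andP => [/seq_leP h|[/seq_leP us /seq_leP ut]].
  by split; apply/seq_leP => x /h[_ /allpairsP[[a b] [/= ai bi ->]]];
    rewrite lexI => /andP[xa xb]; [exists a | exists b].
apply/seq_leP => x xu; have [[a ai xa] [b bi xb]] := (us x xu, ut x xu).
exists (a `&` b); last by rewrite lexI xa.
by apply/allpairsP; exists (a, b).
Qed.

Lemma seq_leUx s t u : seq_le (s ++ t) u = seq_le s u && seq_le t u.
Proof. exact: all_cat. Qed.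

End Xi.

Definition Xi d (X : meetSemilatticeType d) := {eq_quot (@seq_equiv_rel d X)}.

HB.instance Definition _ d (X : meetSemilatticeType d) := Choice.on (Xi X).
HB.instance Definition _ d (X : meetSemilatticeType d) :=
  EqQuotient.on (Xi X).

Definition cls d (X : meetSemilatticeType d) (s : seq X) : Xi X := \pi_(Xi X) s.

Fact Xi_display (d : Order.disp_t) : Order.disp_t.
Proof. exact: Order.Disp tt tt. Qed.

Section XiLattice.
Context {d : Order.disp_t} {X : meetSemilatticeType d}.
Implicit Types (s t u : seq X) (a b c : Xi X).

Lemma cls_repr a : cls (repr a) = a. Proof. exact: reprK. Qed.

Lemma cls_eqP s t : reflect (cls s = cls t) (seq_equiv s t).
Proof. exact: (eqquotP (Xi X)). Qed.

Lemma repr_cls s : seq_equiv (repr (cls s)) s.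
Proof. by apply/cls_eqP; rewrite cls_repr. Qed.

Definition Xi_le a b := seq_le (repr a) (repr b).
Definition Xi_meet a b : Xi X := cls (seq_meet (repr a) (repr b)).
Definition Xi_join a b : Xi X := cls (repr a ++ repr b).

Lemma Xi_le_cls s t : Xi_le (cls s) (cls t) = seq_le s t.
Proof.
have [/andP[s1 s2] /andP[t1 t2]] := (repr_cls s, repr_cls t).
apply/idP/idP => h; first exact: seq_le_trans s2 (seq_le_trans h t1).
exact: seq_le_trans s1 (seq_le_trans h t2).
Qed.

Lemma Xi_le_refl : reflexive Xi_le.
Proof. by move=> a; apply: seq_le_refl. Qed.

Lemma Xi_le_anti : antisymmetric Xi_le.
Proof. by move=> a b ab; rewrite -(cls_repr a) -(cls_repr b); apply/cls_eqP. Qed.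

Lemma Xi_le_trans : transitive Xi_le.
Proof. by move=> b a c; apply: seq_le_trans. Qed.

HB.instance Definition _ := Order.Le_isPOrder.Build (Xi_display d) (Xi X)
  Xi_le_refl Xi_le_anti Xi_le_trans.

Lemma Xi_lexI a b c : (a <= Xi_meet b c) = (a <= b) && (a <= c).
Proof.
by rewrite -{1}(cls_repr a) [LHS]Xi_le_cls seq_lexI.
Qed.

Lemma Xi_leUx a b c : (Xi_join a b <= c) = (a <= c) && (b <= c).
Proof.
by rewrite -{1}(cls_repr c) [LHS]Xi_le_cls seq_leUx.
Qed.

HB.instance Definition _ :=
  Order.POrder_MeetJoin_isLattice.Build (Xi_display d) (Xi X) Xi_lexI Xi_leUx.

Lemma le_cls s t : (cls s <= cls t) = seq_le s t.
Proof. exact: Xi_le_cls. Qed.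

Lemma cls_meet s t : cls s `&` cls t = cls (seq_meet s t).
Proof.
apply/eqP; rewrite eq_le; apply/andP; split.
  by rewrite -[_ `&` _]cls_repr le_cls seq_lexI -!le_cls cls_repr leIl leIr.
by rewrite lexI !le_cls -seq_lexI seq_le_refl.
Qed.

Lemma cls_join s t : cls s `|` cls t = cls (s ++ t).
Proof.
apply/eqP; rewrite eq_le; apply/andP; split.
  by rewrite leUx !le_cls -seq_leUx seq_le_refl.
by rewrite -[_ `|` _]cls_repr le_cls seq_leUx -!le_cls cls_repr leUl leUr.
Qed.

End XiLattice.

(* A semilattice need not have a top, so the meet over a finite index set is
   computed in [option Y]; it is [None] only on the empty index set. *)
Definition bigmeet d (Y : meetSemilatticeType d) N (y : N.-tuple Y)
    (b : {set 'I_N}) : option Y :=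
  \big[oAC (@meetA d Y) (@meetC d Y)/None]_(n in b) Some (tnth y n).

Lemma bigmeetP d (Y : meetSemilatticeType d) N (y : N.-tuple Y)
    (b : {set 'I_N}) : b != finset.set0 ->
  exists2 m, bigmeet y b = Some m &
    forall z, (z <= m) = [forall n in b, z <= tnth y n].
Proof.
have H (r : seq 'I_N) : if \big[oAC (@meetA d Y) (@meetC d Y)/None]_(n <- r)
    Some (tnth y n) is Some m
    then forall z, (z <= m) = all (fun n => z <= tnth y n) r else r = [::].
  elim: r => [|n r]; rewrite ?big_nil ?big_cons //.
  case: (bigop _ _ _) => [m|] ih.
    by rewrite oACE => z; rewrite lexI ih.
  by rewrite ih => z /=; rewrite andbT.
have := H (enum b); rewrite /bigmeet -big_enum /=.
case: (bigop _ _ _) => [m hm _|e]; last first.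
  by case/set0Pn => i; rewrite -mem_enum e.
exists m => // z; rewrite hm; apply/allP/forall_inP => h n nb.
  by apply: h; rewrite mem_enum.
by apply: h; rewrite -mem_enum.
Qed.

Local Open Scope ring_scope.

Definition nu N (b : {set 'I_N}) : int := (-1) ^+ (1 + #|b|).

(* For [N = 0] the sum is empty, so [corresponds] below gives [T (cls [::]) = 0];
   [modular] excludes [N = 0], which would force [f] to vanish at a least
   element of [Y]. *)
Definition incl_excl d (Y : meetSemilatticeType d) (G : zmodType) (f : Y -> G)
    N (y : N.-tuple Y) : G :=
  \sum_(b : {set 'I_N} | b != finset.set0) oapp f 0 (bigmeet y b) *~ nu b.

Definition modular d (Y : meetSemilatticeType d) (G : zmodType) (f : Y -> G) :=
  forall N (y : N.-tuple Y) (s : Y), (0 < N)%N ->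
    isLub (range (tnth y)) s -> f s = incl_excl f y.

Definition corresponds d (X : meetSemilatticeType d) (G : zmodType)
    (f : X -> G) (T : Xi X -> G) :=
  forall N (x : N.-tuple X), T (cls x) = incl_excl f x.

(* [porderZmodType] does not require the order to be translation invariant. *)
Definition group_order (G : zmodType) (leG : rel G) :=
  [/\ reflexive leG, antisymmetric leG, transitive leG
    & forall z : G, {homo +%R z : x y / leG x y}].

(* Main.v *)
(* The inclusion-exclusion sum of [f] over a sequence obeys the recursion
   [ie f (x :: s) = f x + ie f s - ie (f o (x /\ _)) s].  Hence it is unchanged
   when the terms are permuted or when a term lying below another one is
   dropped, so it depends only on the class of the sequence.  For the resulting
   [T], the quantity [T xi + T zeta - T (xi \/ zeta)] is the inclusion-exclusion
   sum over [xi] of [x |-> T ([x] /\ zeta)], in which [zeta] may be replaced by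
   [xi /\ zeta]; hence it equals [T (xi /\ zeta)].  This binary identity gives
   modularity by induction, and, for [xi = [x]], the criterion (ii). *)
Require Import Defs.
From HB Require Import structures.
From mathcomp Require Import all_boot all_order all_algebra.
From mathcomp Require Import boolp classical_sets functions.
Import Order.TTheory GRing.Theory.
Local Open Scope classical_set_scope.
Local Open Scope ring_scope.

(** * Inclusion-exclusion sums along a sequence *)

Section InclusionExclusion.
Context {d : Order.disp_t} {Y : meetSemilatticeType d} {G : zmodType}.
Implicit Types (f g : Y -> G) (x y z : Y) (s t : seq Y).

(** The nonempty index sets are split into the singleton of the head, those avoiding the head, and
    those properly containing it; [incl_excl_ie] links this to sums over subsets. *)
Fixpoint ie f s : G :=
  if s is x :: s' then f x + ie f s' - ie (fun y => f (x `&` y)%O) s' else 0.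

(** Every meet that enters the sum lies below some entry of [s]. *)
Lemma eq_ie_below f g s :
  (forall x, has (fun z => x <= z)%O s -> f x = g x) -> ie f s = ie g s.
Proof.
elim: s f g => [//|x s ih] f g fg /=.
rewrite fg /= ?lexx //; congr (_ + _ - _); apply: ih => z zs.
  by apply: fg; rewrite /= zs orbT.
by apply: fg; rewrite /= leIl.
Qed.

Lemma eq_ie f g s : f =1 g -> ie f s = ie g s.
Proof. by move=> fg; apply: eq_ie_below => x _; apply: fg. Qed.

Lemma ieB f g s : ie (fun y => f y - g y) s = ie f s - ie g s.
Proof.
elim: s f g => [|x s ih] f g /=; first by rewrite subr0.
by rewrite !ih !opprB !opprD !addrA [LHS](ACl (1*3*6*5*2*4)).
Qed.

Lemma ie_cons_swap f x y s : ie f [:: x, y & s] = ie f [:: y, x & s].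
Proof.
rewrite /= !opprB !opprD !addrA meetC.
rewrite [LHS](ACl (2*1*3*7*5*6*4)) /=; congr (_ + _ - _ - _).
by apply: eq_ie => z; rewrite meetCA.
Qed.

Lemma ie_cat_cons f x s t : ie f (s ++ x :: t) = ie f (x :: s ++ t).
Proof.
elim: s f => [//|y s ih] f.
by rewrite !cat_cons ie_cons_swap /= !ih.
Qed.

Lemma ie_catC f s t : ie f (s ++ t) = ie f (t ++ s).
Proof.
elim: t f => [|x t ih] f; first by rewrite cats0.
by rewrite ie_cat_cons /= !ih.
Qed.

(** If [x] lies below the head, the two tail sums cancel. If it lies below a later entry, induction
    collapses both tail sums to single values, and the one at the meet of [z] and [x] cancels. *)
Lemma ie_meet_below f x s :
  has (fun z => x <= z)%O s -> ie (fun y => f (x `&` y)%O) s = f x.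
Proof.
elim: s f => [//|z s ih] f /= /orP[xz|xs].
  rewrite (meet_idPl xz); under [X in _ - X]eq_ie => y.
    by rewrite meetA (meet_idPl xz); over.
  by rewrite addrK.
rewrite (ih _ xs); under [X in _ - X]eq_ie => y.
  by rewrite meetCA; over.
by rewrite (ih (fun y => f (z `&` y)%O) xs) meetC addrAC subrr add0r.
Qed.

Lemma ie_seq_le_cat f s t : seq_le s t -> ie f (s ++ t) = ie f t.
Proof.
elim: s => [//|x s ih] /= /andP[xt st].
(* As [x] lies below an entry of [t], the subtracted sum is [f x], which cancels the head term. *)
rewrite ie_meet_below ?has_cat ?xt ?orbT // ih //.
by rewrite addrAC subrr add0r.
Qed.

Lemma ie_equiv f s t : seq_equiv s t -> ie f s = ie f t.
Proof.
by case/andP=> st ts; rewrite -(ie_seq_le_cat _ _ _ st) ie_catC ie_seq_le_cat.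
Qed.

Lemma ie_cat f s t :
  ie f (s ++ t) =
  ie f s + ie f t - ie (fun x => ie (fun y => f (x `&` y)%O) t) s.
Proof.
elim: s f => [|x s ih] f /=; first by rewrite subr0 add0r.
rewrite !ih /= !opprB !opprD !addrA.
rewrite [LHS](ACl (1*2*6*3*5*7*4)) /=; congr (_ + _ - _ - _).
by apply: eq_ie => z; apply: eq_ie => y; rewrite meetA.
Qed.

End InclusionExclusion.

Lemma ie_map d d' (X : meetSemilatticeType d) (Y : meetSemilatticeType d')
    (G : zmodType) (h : X -> Y) (f : Y -> G) (s : seq X) :
  {morph h : x y / (x `&` y)%O} -> ie f (map h s) = ie (f \o h) s.
Proof.
move=> hM; elim: s f => [//|x s ih] f /=; rewrite !ih; congr (_ + _ - _).
by apply: eq_ie => y /=; rewrite hM.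
Qed.

(** * The same recursion for the sum over subsets *)

Section InclExclRecursion.
Context {d : Order.disp_t} {Y : meetSemilatticeType d} {G : zmodType}.
Context {N : nat}.
Implicit Types (f : Y -> G) (x : Y) (y : N.-tuple Y) (c : {set 'I_N}).

(** Index sets without [ord0] have the form [up c], those with it the form [ord0 |: up c]; preimage
    under [lift ord0] recovers [c] in both cases. *)
Let up c : {set 'I_N.+1} := [set lift ord0 i | i in c].

Lemma ord0_notin_lift c : ord0 \notin up c.
Proof. by apply/imsetP => -[i _ /eqP]; rewrite (negPf (neq_lift _ _)). Qed.

Lemma lift_preimsetK (b : {set 'I_N.+1}) : b :\ ord0 = up (lift ord0 @^-1: b).
Proof.
apply/setP => i; rewrite !inE; apply/andP/imsetP => [[i0 ib]|[j]].
  by case: (unliftP ord0 i) i0 ib => [j ->|->] // _ ib; exists j; rewrite ?inE.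
by rewrite inE => jb ->; rewrite eq_sym neq_lift.
Qed.

Lemma lift_imsetK c : lift ord0 @^-1: up c = c.
Proof.
by apply/setP => i; rewrite inE mem_imset //; apply: lift_inj.
Qed.

Lemma lift_setU1K c : lift ord0 @^-1: (ord0 |: up c) = c.
Proof.
rewrite -[RHS]lift_imsetK; apply/setP => i.
by rewrite !inE eq_sym (negPf (neq_lift _ _)).
Qed.

Lemma setU1_ord0_neq0 c : ord0 |: up c != finset.set0.
Proof. by apply/set0Pn; exists ord0; rewrite setU11. Qed.

Lemma bigmeet_lift x y c : bigmeet [tuple of x :: y] (up c) = bigmeet y c.
Proof.
rewrite /bigmeet big_imset /=; last by move=> i j _ _; apply: lift_inj.
by apply: eq_bigr => i _; rewrite tnthS.
Qed.

(** The default [x] covers empty [c], where [bigmeet y c] is [None]. *)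
Lemma bigmeet_cons x y c :
  bigmeet [tuple of x :: y] (ord0 |: up c) =
  Some (oapp (Order.meet x) x (bigmeet y c)).
Proof.
rewrite -(bigmeet_lift x) /bigmeet big_setU1 ?ord0_notin_lift //= tnth0.
by case: (bigop _ _ _).
Qed.

Lemma incl_excl_cons f x y :
  incl_excl f [tuple of x :: y] =
  f x + incl_excl f y - incl_excl (fun z => f (x `&` z)%O) y.
Proof.
rewrite /incl_excl (bigID (fun b : {set 'I_N.+1} => ord0 \in b)) /=.
rewrite addrAC; congr (_ + _); last first.
  rewrite (reindex_onto up (fun b => lift ord0 @^-1: b)) /=; last first.
    move=> b /andP[_ b0]; rewrite -lift_preimsetK.
    by apply/finset.setDidPl; rewrite disjoint_sym disjoints1.
  apply: eq_big => c.
    by rewrite ord0_notin_lift lift_imsetK eqxx !andbT imset_eq0.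
  by rewrite bigmeet_lift /nu card_imset //; apply: lift_inj.
rewrite (reindex_onto (fun c => ord0 |: up c) (fun b => lift ord0 @^-1: b))
  /=; last first.
  by move=> b /andP[_ b0]; rewrite -lift_preimsetK finset.setD1K.
have nuU1 c : nu (ord0 |: up c) = - nu c.
  rewrite /nu cardsU1 ord0_notin_lift card_imset; last exact: lift_inj.
  by rewrite !exprS mulN1r.
rewrite (eq_bigl predT) => [|c]; last first.
  by rewrite setU1_ord0_neq0 setU11 lift_setU1K eqxx.
(* Empty [c] stands for the singleton of [ord0] and yields [f x]; the other [c] give the subtracted
   sum, with the sign from [nuU1]. *)
rewrite (bigD1 finset.set0) //=; congr (_ + _).
  by rewrite bigmeet_cons /bigmeet big_set0 nuU1 /nu cards0 expr1 opprK.
rewrite -sumrN; apply: eq_bigr => c c0; rewrite bigmeet_cons nuU1.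
by have [m -> _] := bigmeetP y c0; rewrite mulrNz.
Qed.

End InclExclRecursion.

Lemma incl_excl_ie d (Y : meetSemilatticeType d) (G : zmodType) (f : Y -> G)
    N (y : N.-tuple Y) : incl_excl f y = ie f y.
Proof.
elim: N y f => [|N ih] y f.
  rewrite tuple0 /incl_excl big1 // => b /set0Pn[[]] //.
by case/tupleP: y => x y; rewrite incl_excl_cons !ih.
Qed.

(** * From functions on [X] to modular functions on [Xi X] *)

Section Extension.
Context {d : Order.disp_t} {X : meetSemilatticeType d} {G : zmodType}.
Implicit Types (f : X -> G) (a b c : Xi X) (l : seq (Xi X)).

Lemma cls1M : {morph (fun x : X => cls [:: x]) : x y / (x `&` y)%O}.
Proof. by move=> x y; rewrite cls_meet. Qed.

Lemma cls1_inj : injective (fun x : X => cls [:: x]).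
Proof.
move=> x y /cls_eqP; rewrite /seq_equiv /= !orbF !andbT => xy.
exact: le_anti.
Qed.

Lemma cls0_le a : (cls [::] <= a)%O.
Proof. by rewrite -(cls_repr a) le_cls. Qed.

(** Both sides are represented by sequences with the same members. *)
Lemma cls_meetUr a b c : (a `&` (b `|` c) = (a `&` b) `|` (a `&` c))%O.
Proof.
rewrite -(cls_repr a) -(cls_repr b) -(cls_repr c) !(cls_join, cls_meet).
apply/cls_eqP/andP; split; apply/seq_leP => x xs; exists x => //; move: xs.
  by rewrite mem_allpairs_catr mem_cat.
by rewrite [in X in _ -> X]mem_allpairs_catr mem_cat.
Qed.

Lemma foldr_join_le l c :
  (foldr Order.join (cls [::]) l <= c)%O = all (fun a => a <= c)%O l.
Proof. by elim: l => [|a l ih] /=; rewrite ?cls0_le // leUx ih. Qed.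

Lemma isLub_foldr_join N (y : N.-tuple (Xi X)) a :
  isLub (range (tnth y)) a -> a = foldr Order.join (cls [::]) y.
Proof.
move=> [ya lea]; apply/le_anti/andP; split; last first.
  rewrite foldr_join_le; apply/allP => _ /tnthP[i ->].
  by apply: ya; exists i.
have /allP/= h := etrans (esym (foldr_join_le y _)) (lexx _).
by apply: lea => _ [i _ <-]; apply: h; apply: mem_tnth.
Qed.

(** Through this, modularity determines a function on [Xi X] from its values at singleton
    classes. *)
Lemma isLub_cls N (x : N.-tuple X) :
  isLub (range (tnth (map_tuple (fun z => cls [:: z]) x))) (cls x).
Proof.
split=> [_ [i _ <-]|b hb].
  rewrite tnth_map le_cls /= andbT; apply/hasP.
  by exists (tnth x i); rewrite ?mem_tnth.
rewrite -(cls_repr b) le_cls; apply/allP => _ /tnthP[i ->].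
have : (cls [:: tnth x i] <= b)%O by apply: hb; exists i; rewrite ?tnth_map.
by rewrite -{1}(cls_repr b) le_cls /= andbT.
Qed.

Definition extension f (a : Xi X) : G := ie f (repr a).

Lemma extension_cls f (s : seq X) : extension f (cls s) = ie f s.
Proof. exact: ie_equiv (repr_cls s). Qed.

Lemma extension_cls1 f (x : X) : extension f (cls [:: x]) = f x.
Proof. by rewrite extension_cls /= addr0 subr0. Qed.

(** The meet is represented by [repr a] with each entry met with [x], and meeting with [x] preserves
    meets. *)
Lemma extensionI1 f (x : X) a :
  extension f (cls [:: x] `&` a)%O = ie (fun y => f (x `&` y)%O) (repr a).
Proof.
rewrite -{1}(cls_repr a) cls_meet extension_cls /seq_meet /= cats0.
by apply: ie_map => y z; rewrite meetACA meetxx.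
Qed.

Lemma extensionU f a b :
  extension f (a `|` b)%O =
  extension f a + extension f b - extension f (a `&` b)%O.
Proof.
(* This is [ie_cat] for representatives of [a] and [c], solved for the double sum. *)
have cross c : ie (fun x => extension f (cls [:: x] `&` c)%O) (repr a) =
    extension f a + extension f c - extension f (a `|` c)%O.
  rewrite -{3}(cls_repr a) -{3}(cls_repr c) cls_join extension_cls ie_cat.
  rewrite opprB addrC subrK; apply: eq_ie => x; exact: extensionI1.
suff -> : extension f (a `&` b)%O =
    extension f a + extension f b - extension f (a `|` b)%O.
  by rewrite opprB addrC subrK.
rewrite -cross; transitivity (extension f a + extension f (a `&` b)%O
    - extension f (a `|` (a `&` b))%O).
  by rewrite meetKU addrAC subrr add0r.
(* Only [x] with [cls [:: x] <= a] matter, and for these the extra meet with [a] is absorbed. *)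
rewrite -cross; apply: eq_ie_below => x xa.
rewrite meetA (meet_idPl (_ : cls [:: x] <= a)%O) //.
by rewrite -(cls_repr a) le_cls /= xa.
Qed.

(** The induction varies [V]: by distributivity, meeting the argument with [a] first again gives a
    valuation vanishing at the bottom. *)
Lemma valuation_foldr_join (V : Xi X -> G) l : V (cls [::]) = 0 ->
    (forall a b, V (a `|` b)%O = V a + V b - V (a `&` b)%O) ->
  V (foldr Order.join (cls [::]) l) = ie V l.
Proof.
elim: l V => [//|a l ih] V V0 VU /=; rewrite VU ih //; congr (_ + _ - _).
apply: (ih (fun b => V (a `&` b)%O)) => [|b c].
  by rewrite (meet_idPr (cls0_le a)).
by rewrite cls_meetUr VU meetACA meetxx.
Qed.

Lemma extension_modular f : modular (extension f).
Proof.
move=> N y a _ ya; rewrite (isLub_foldr_join _ _ _ ya) incl_excl_ie.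
apply: valuation_foldr_join; [exact: extension_cls | exact: extensionU].
Qed.

Lemma modular_cls (T : Xi X -> G) (s : seq X) : modular T -> T (cls [::]) = 0 ->
  T (cls s) = ie (fun x => T (cls [:: x])) s.
Proof.
(* The empty sequence is settled by [T (cls [::]) = 0], since [modular] speaks only of [0 < N]. *)
case: s => [//|x s] Tm _.
rewrite -(ie_map _ _ _ _ _ _ _ _ cls1M).
rewrite (Tm _ _ _ (ltn0Sn (size s)) (isLub_cls _ (in_tuple (x :: s)))).
exact: incl_excl_ie.
Qed.

Lemma extension_is_zmod_morphism : zmod_morphism extension.
Proof. by move=> f g; apply/funext => a; apply: ieB. Qed.

Lemma correspondsP f (T : Xi X -> G) : corresponds f T <-> T = extension f.
Proof.
split=> [fT|-> N x]; last by rewrite extension_cls incl_excl_ie.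
apply/funext => a; rewrite -[in LHS](cls_repr a).
by rewrite (fT _ (in_tuple (repr a))) incl_excl_ie.
Qed.

Lemma extension_homo (leG : rel G) f : group_order leG ->
  (forall a x, (a <= cls [:: x])%O -> leG (extension f a) (f x)) ->
  {homo extension f : a b / (a <= b)%O >-> leG a b}.
Proof.
move=> [leGxx _ leG_trans leGD] fle.
(* If [a <= b], then [b] arises from [a] by joining the entries of [repr b] one at a time. *)
have grow a s : leG (extension f a) (extension f (cls s `|` a)%O).
  elim: s => [|x s ih]; first by rewrite (join_idPr (cls0_le a)).
  rewrite -[x :: s]cat1s -cls_join -joinA; apply: leG_trans ih _.
  (* Joining [cls [:: x]] to [b] adds [f x] minus the value at their meet, and that meet lies below
     [cls [:: x]]. *)
  set b := (_ `|` a)%O; rewrite extensionU extension_cls1 addrAC addrC.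
  have := leGD (extension f b - extension f (cls [:: x] `&` b)%O) _ _
    (fle _ _ (leIl (cls [:: x]) b)).
  by rewrite subrK addrAC addrA.
move=> a b ab; have := grow a (repr b).
by rewrite cls_repr (join_idPl ab).
Qed.

End Extension.

(** * Embedding, group isomorphism and the two criteria *)

Theorem theorem1 (d : Order.disp_t) (X : meetSemilatticeType d) (G : zmodType) :
  (* x |-> [x] is a semilattice embedding *)
  (injective (fun x : X => cls [:: x]) /\
   {morph (fun x : X => cls [:: x]) : x y / (x `&` y)%O >-> (x `&` y)%O}) /\
  (* the group isomorphism *)
  (exists Phi : {additive (X -> G) -> (Xi X -> G)},
     set_bij setT [set T : Xi X -> G | modular T /\ T (cls [::]) = 0] Phi /\
     forall f : X -> G, corresponds f (Phi f)) /\
  (forall (f : X -> G) (T : Xi X -> G), corresponds f T ->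
     (* (i) *)
     (modular f <->
        forall N (x : N.-tuple X) (s : X), (0 < N)%N ->
          isLub (range (tnth x)) s -> T (cls x) = T (cls [:: s])) /\
     (* (ii) *)
     (forall leG : rel G, group_order leG ->
        {homo T : xi zeta / (xi <= zeta)%O >-> leG xi zeta} <->
        (forall (xi : Xi X) (x : X),
           (xi <= cls [:: x])%O -> leG (T xi) (f x)))).
Proof.
split; first by split; [exact: cls1_inj | exact: cls1M].
split.
  pose Phi_mixin := GRing.isZmodMorphism.Build (X -> G) (Xi X -> G) extension
    extension_is_zmod_morphism.
  pose Phi : {additive (X -> G) -> (Xi X -> G)} :=
    HB.pack (extension : (X -> G) -> (Xi X -> G)) Phi_mixin.
  exists Phi; split; last by move=> f; apply/correspondsP.
  split=> [f _|f g _ _ fg|T [Tm T0]].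
  - by split; [exact: extension_modular | exact: extension_cls].
  - apply/funext => x; rewrite -[f x]extension_cls1 -[g x]extension_cls1.
    by congr (_ _).
  (* The preimage of [T] is its restriction to singleton classes. *)
  - exists (fun x => T (cls [:: x])) => //; apply/funext => a.
    by rewrite -[in RHS](cls_repr a) modular_cls.
move=> f T /correspondsP ->; split=> [|leG leGP]; split.
(* The values at [cls x] and [cls [:: s]] are [incl_excl f x] and [f s], so (i) is the modularity
   equation itself. *)
- move=> fm N x s N0 xs.
  by rewrite extension_cls1 extension_cls (fm _ _ _ N0 xs) incl_excl_ie.
- move=> h N x s N0 xs.
  by rewrite -extension_cls1 -(h _ _ _ N0 xs) extension_cls incl_excl_ie.
- by move=> Th a x /Th; rewrite extension_cls1.
- exact: extension_homo.
Qed.
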